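(* Let $q\in[0,1)$, let $N\in\mathbb{N}$, and let $w$ be the random permutation of $\{1,\dots,N\}$ distributed according to the Mallows measure $\mathcal{M}_{N}^{q}$. Let $r \in \mathbb{N}$, $1 \le K \le N$, $1 \le L_1 \le L_2\le \dots \le L_r \le N$ be integers, put $L_0:=0$, and let $(s_1, \dots, s_r)$ be non-negative integers such that $\max\{L_i-L_{i-1}+K-N, 0\} \leq s_i \leq \min\{L_i-L_{i-1},K\}$ for $i=1,\dots,r$. Then $$\mathcal{M}_{N}^{q} \left( H^{(N)}_{L_1, L_2, \dots, L_r; K} (w ) = (s_1,s_2, \dots, s_r) \right) = \prod_{i=1}^r \mathcal{M}_{N-L_{i-1}}^{q} \left( H^{(N-L_{i-1})}_{L_i-L_{i-1},\; K-s_1-s_2-\dots-s_{i-1} } = s_i \right).$$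
   Context: For $q\in[0,1)$, the Mallows measure $\mathcal{M}_M^q$ on permutations of $\{1,\dots,M\}$ assigns to a permutation $w$ the probability $q^{\mathrm{inv}(w)}Y_M$, where $\mathrm{inv}(w)$ is the number of inversions of $w$ and $Y_M=\prod_{j=1}^M\frac{1-q}{1-q^j}$ (with $0^0=1$; for $M=0$ it is the point mass on the empty permutation). For a permutation $w$ of $\{1,\dots,M\}$ and integers $L,\hat L,K$: $H^{(M)}_{L,K}(w):=\#\{i: 1\le i\le L,\ 1\le w(i)\le K\}$ and $H^{(M)}_{[L,\hat L],K}(w):=\#\{i: L\le i\le \hat L,\ 1\le w(i)\le K\}$, where a count over an empty range of $i$ or of values $w(i)$ is $0$. The multi-point height function is the vector $$H^{(N)}_{L_1, \dots, L_r; K} (w ) := \left( H^{(N)}_{L_1,K}(w), H^{(N)}_{[L_1+1,L_2],K}(w), \dots, H^{(N)}_{[L_{r-1}+1,L_r],K}(w) \right).$$ In the factor with index $i$ on the right-hand side, $H^{(N-L_{i-1})}_{\cdot,\cdot}$ is evaluated at a random permutation of size $N-L_{i-1}$ with distribution $\mathcal{M}^q_{N-L_{i-1}}$. *)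

(* Defs.v *)
From mathcomp Require Import all_boot all_order all_algebra all_fingroup.

Set Implicit Arguments.
Unset Strict Implicit.
Unset Printing Implicit Defensive.

Import Order.TTheory GRing.Theory Num.Theory.
Local Open Scope ring_scope.

(* A permutation of {1, ..., M} is an element w of 'S_M, which acts on
   {0, ..., M - 1}: the position i and the value w i of the mathematics are the
   successors i.+1 and (w i).+1 here. *)

Definition inversions (M : nat) (w : 'S_M) : nat :=
  #|[set p : 'I_M * 'I_M | (p.1 < p.2)%N && (w p.2 < w p.1)%N]|.

Definition mallows_weight (R : realFieldType) (q : R) (M : nat) (w : 'S_M) : R :=
  q ^+ inversions w * \prod_(1 <= j < M.+1) ((1 - q) / (1 - q ^+ j)).

Definition mallows (R : realFieldType) (q : R) (M : nat) (E : {set 'S_M}) : R :=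
  \sum_(w in E) mallows_weight q w.

(* The bounds are integers, so that an upper bound K <= 0 on the values (or an
   upper bound on the positions below the lower one) gives the count 0. *)
Definition height_seg (M : nat) (L L' K : int) (w : 'S_M) : nat :=
  #|[set i : 'I_M | (L <= (i.+1)%:Z <= L') && (1 <= ((w i).+1)%:Z <= K)]|.

Definition height (M : nat) (L K : int) (w : 'S_M) : nat := height_seg 1 L K w.

(* L is indexed from 1: the i-th entry (i : 'I_r) is the one of L_{i+1}. *)
Definition multi_height (M r : nat) (L : nat -> nat) (K : int) (w : 'S_M) :
    r.-tuple nat :=
  [tuple if (i : nat) == 0%N then height (L 1%N)%:Z K w
         else height_seg ((L i)%:Z + 1) (L i.+1)%:Z K w | i < r].

(* Main.v *)
Require Import Defs.
From mathcomp Require Import all_boot all_order all_algebra all_fingroup.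
From mathcomp Require Import zify.

Set Implicit Arguments.
Unset Strict Implicit.
Unset Printing Implicit Defensive.

Import Order.TTheory GRing.Theory Num.Theory.
Local Open Scope ring_scope.

(** For fixed [K], the height functions of a permutation [w] only depend on the
    binary word whose [i]-th letter says whether [w i] is one of the [K]
    smallest values.  Under the Mallows measure this word is produced by a
    Markov mechanism: a permutation of size [M + 1] is the same thing as its
    first value [k] together with the permutation of size [M] obtained by
    standardizing the remaining values, and the number of inversions is [k] plus
    that of the standardization.  So, given the first value, the rest of the
    permutation is again Mallows distributed, and among its values those coming
    from values at most [K] are the smallest [K] or [K - 1], according to the
    first letter of the word (mean_recl).

    Iterating over the first [d] positions, if these carry [s] small values then
    the rest of the word is that of a Mallows permutation of size [M - d] with
    threshold [K - s] (mean_Markov).  Iterating this over the successive blocks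
    of positions gives the product formula (mean_blocks).  The truncated
    difference [K - s] is harmless: a negative threshold leaves no small value,
    just as the threshold 0 does. *)

(** The word of [w] at threshold [K]: its [i]-th letter, counted from 0, tells
    whether [w i < K], that is, whether the value at position [i + 1] of
    [{1, ..., M}] is at most [K]. *)
Definition small_word (M K : nat) (w : 'S_M) : seq bool :=
  [seq (w i < K)%N | i <- enum 'I_M].

(** The expectation, under the Mallows measure on permutations of size [M], of a
    function [F] of the word at threshold [K]. *)
Definition mean (R : realFieldType) (q : R) (M K : nat)
    (F : seq bool -> R) : R :=
  \sum_(w : 'S_M) mallows_weight q w * F (small_word K w).

(** * Removing the first value of a permutation *)

Lemma ltn_bump (k x K : nat) : (bump k x < K)%N = (x < K - (k < K))%N.
Proof. by rewrite /bump; lia. Qed.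

Lemma inversionsE (M : nat) (w : 'S_M) :
  inversions w = (\sum_(i < M) \sum_(j < M) ((i < j) && (w j < w i)))%N.
Proof.
by rewrite /inversions cardsE -sum1_card big_mkcond pair_bigA.
Qed.

Lemma sum_ord_ltn (M k : nat) :
  (k <= M)%N -> (\sum_(x < M) (x < k : nat))%N = k.
Proof.
move=> kM; rewrite -[RHS]card_ord -sum1_card.
by rewrite (big_ord_widen _ (fun=> 1%N) kM) [RHS]big_mkcond.
Qed.

Lemma inversions_lift_perm (M : nat) (k : 'I_M.+1) (w : 'S_M) :
  inversions (lift_perm ord0 k w) = (k + inversions w)%N.
Proof.
rewrite !inversionsE big_ord_recl; congr (_ + _)%N.
  rewrite big_ord_recl /= add0n -[RHS](@sum_ord_ltn M); last by rewrite -ltnS.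
  rewrite [RHS](reindex_inj (@perm_inj _ w)); apply: eq_bigr => j _ /=.
  by rewrite lift_perm_id lift_perm_lift /= ltn_bump ltnn subn0.
apply: eq_bigr => i _; rewrite big_ord_recl /= add0n.
apply: eq_bigr => j _; rewrite !lift_perm_lift /=.
by rewrite /bump !leq0n !add1n; lia.
Qed.

(** Once the first value [k] is removed, the threshold for the standardized
    values drops by 1 exactly when [k] is itself below the threshold. *)
Lemma small_word_lift_perm (M K : nat) (k : 'I_M.+1) (w : 'S_M) :
  small_word K (lift_perm ord0 k w) =
  (k < K)%N :: small_word (K - (k < K)) w.
Proof.
rewrite /small_word enum_ordSl /= lift_perm_id -map_comp; congr (_ :: _).
by apply: eq_map => i /=; rewrite lift_perm_lift /= ltn_bump.
Qed.

(** A permutation of size [M + 1] is determined by its first value and the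
    standardization of the others, both of which are arbitrary. *)
Lemma sum_lift_perm (V : nmodType) (M : nat) (F : 'S_M.+1 -> V) :
  \sum_(w : 'S_M.+1) F w =
  \sum_(k < M.+1) \sum_(w : 'S_M) F (lift_perm ord0 k w).
Proof.
rewrite pair_bigA (reindex (fun p => lift_perm ord0 p.1 p.2)) //=.
apply: onW_bij; apply: inj_card_bij; last first.
  by rewrite card_prod !card_Sn card_ord factS.
move=> [k w] [k' w'] /= /permP eq_ww'.
have eqk : k = k' by have := eq_ww' ord0; rewrite !lift_perm_id.
rewrite -eqk in eq_ww' *; congr pair; apply/permP => i.
by have := eq_ww' (lift ord0 i); rewrite !lift_perm_lift => /lift_inj.
Qed.

(** * The binary word of a Mallows permutation *)

Section Mallows.
Variables (R : realFieldType) (q : R).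

Lemma mallows_weight_lift_perm (M : nat) (k : 'I_M.+1) (w : 'S_M) :
  mallows_weight q (lift_perm ord0 k w) =
  (1 - q) / (1 - q ^+ M.+1) * q ^+ k * mallows_weight q w.
Proof.
rewrite /mallows_weight inversions_lift_perm exprD big_nat_recr //=.
by rewrite [LHS]mulrA [LHS]mulrC !mulrA.
Qed.

Lemma eq_mean (M K : nat) (F G : seq bool -> R) :
  F =1 G -> mean q M K F = mean q M K G.
Proof. by move=> eqFG; apply: eq_bigr => w _; rewrite eqFG. Qed.

Lemma mean0 (M K : nat) : mean q M K (fun=> 0) = 0.
Proof. by rewrite /mean big1 // => w _; rewrite mulr0. Qed.

(** First-step decomposition of the word of a Mallows permutation. *)
Lemma mean_recl (M K : nat) (F : seq bool -> R) :
  mean q M.+1 K F =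
  \sum_(k < M.+1) (1 - q) / (1 - q ^+ M.+1) * q ^+ k *
    mean q M (K - (k < K)) (fun v => F ((k < K)%N :: v)).
Proof.
rewrite /mean sum_lift_perm; apply: eq_bigr => k _.
rewrite mulr_sumr; apply: eq_bigr => w _.
by rewrite mallows_weight_lift_perm small_word_lift_perm !mulrA.
Qed.

Hypothesis hq : 0 <= q < 1.

(** The Mallows weights form a probability distribution. *)
Lemma mean1 (M K : nat) : mean q M K (fun=> 1) = 1.
Proof.
elim: M K => [|M IHM] K.
  rewrite /mean (eq_bigr (fun=> 1)) => [|w _].
    by rewrite sumr_const (@eq_card _ _ 'S_0) ?card_Sn.
  rewrite mulr1 /mallows_weight big_geq // mulr1 /inversions.
  by rewrite eq_card0 ?expr0 // => -[[]].
have [q0 q1] := andP hq.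
have nz_qM : 1 - q ^+ M.+1 != 0.
  by rewrite subr_eq0 eq_sym lt_eqF // exprn_ilt1.
rewrite mean_recl; under eq_bigr do rewrite IHM mulr1.
(* The remaining sum over the first value is geometric. *)
by rewrite -mulr_sumr mulrAC -opprB mulNr -subrX1 opprB divff.
Qed.

(** Given that [s] of the first [d] letters are true, the rest of the word is
    that of a Mallows permutation of size [M - d] at threshold [K - s].  If
    [K < s], the conditioning event is empty and both sides vanish. *)
Lemma mean_Markov (M K d s : nat) (G : seq bool -> R) : (d <= M)%N ->
  mean q M K (fun v => (count id (take d v) == s)%:R * G (drop d v)) =
  mean q M K (fun v => (count id (take d v) == s)%:R) *
    mean q (M - d) (K - s) G.
Proof.
elim: d M K s => [|d IHd] M K s.
  move=> _; rewrite subn0.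
  case: s => [|s].
    rewrite subn0 [X in _ = X * _](@eq_mean _ _ _ (fun=> 1)) => [|v].
      by rewrite mean1 mul1r; apply: eq_mean => v; rewrite take0 drop0 mul1r.
    by rewrite take0.
  rewrite [X in _ = X * _](@eq_mean _ _ _ (fun=> 0)) => [|v]; last first.
    by rewrite take0.
  rewrite mean0 mul0r -[RHS](mean0 M K).
  by apply: eq_mean => v; rewrite take0 mul0r.
case: M => // M leqdM; rewrite !mean_recl mulr_suml; apply: eq_bigr => k _.
rewrite -[RHS]mulrA; congr (_ * _); rewrite subSS /=.
set b := (k < K)%N; have [leqbs|ltsb] := leqP b s.
  have eqbs v : (b + count id v == s)%N = (count id v == s - b)%N.
    by rewrite -[in LHS](subnKC leqbs) eqn_add2l.
  under eq_mean do rewrite eqbs.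
  under [X in _ = X * _]eq_mean do rewrite eqbs.
  by rewrite IHd // -subnDA subnKC.
(* The first letter alone already exceeds the prescribed count [s = 0]. *)
have neqbs v : (b + count id v == s)%N = false.
  by apply/negbTE; rewrite neq_ltn (leq_trans ltsb) ?leq_addr ?orbT.
under eq_mean do rewrite neqbs mul0r.
under [X in _ = X * _]eq_mean do rewrite neqbs.
by rewrite !mean0 mul0r.
Qed.

(** The product formula for words, for the blocks number [p, ..., r - 1], the
    [i]-th of which occupies the positions from [L i] to [L i.+1 - 1]; the word
    is the one that is left once the blocks before the [p]-th are removed. *)
Lemma mean_blocks (N K r : nat) (L s : nat -> nat) :
  (forall i j, (i <= j <= r)%N -> (L i <= L j)%N) -> (L r <= N)%N ->
  forall p, (p <= r)%N ->
  mean q (N - L p) (K - \sum_(0 <= j < p) s j) (fun v =>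
    (all (fun i => count id (take (L i.+1 - L i) (drop (L i - L p) v)) == s i)
         (index_iota p r))%:R) =
  \prod_(p <= i < r)
    mean q (N - L i) (K - \sum_(0 <= j < i) s j) (fun v =>
      (count id (take (L i.+1 - L i) v) == s i)%:R).
Proof.
move=> homoL leLN p lepr; move def_n: (r - p)%N => n.
elim: n p lepr def_n => [|n IHn] p lepr def_n.
  have -> : p = r by lia.
  by rewrite [RHS]big_geq // /index_iota subnn /= mean1.
have ltpr : (p < r)%N by lia.
rewrite [RHS]big_ltn // -IHn //; last by lia.
have leL : (L p <= L p.+1)%N by apply: homoL; rewrite leqnSn.
have leLr : (L p.+1 <= L r)%N by apply: homoL; rewrite ltpr leqnn.
have -> : (N - L p.+1 = N - L p - (L p.+1 - L p))%N by lia.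
rewrite big_nat_recr //= subnDA -mean_Markov; last by lia.
apply: eq_mean => v; rewrite /index_iota def_n subnS def_n /=.
rewrite subnn drop0 -mulnb natrM; congr (_ * (_ : bool)%:R).
apply: eq_in_all => i; rewrite mem_iota => /andP[ltpi ltir].
have leLi : (L p.+1 <= L i)%N by apply: homoL; lia.
by rewrite drop_drop; congr (count _ (take _ (drop _ _)) == _); lia.
Qed.

Lemma mallows_mean (M K : nat) (E : {set 'S_M}) (P : pred (seq bool)) :
  (forall w, (w \in E) = P (small_word K w)) ->
  mallows q E = mean q M K (fun v => (P v)%:R).
Proof.
move=> defE; rewrite /mallows big_mkcond; apply: eq_bigr => w _.
by rewrite defE; case: (P _); rewrite ?mulr1 ?mulr0.
Qed.

End Mallows.

(** * Height functions in terms of words *)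

Lemma take_drop_enum_ord (M a b : nat) :
  take (b - a) (drop a (enum 'I_M)) =
  [seq i : 'I_M <- enum 'I_M | (a <= i < b)%N].
Proof.
apply: (inj_map val_inj); rewrite map_take map_drop val_enum_ord.
rewrite drop_iota take_iota add0n.
have -> : [seq val i | i <- [seq i : 'I_M <- enum 'I_M | (a <= i < b)%N]] =
          [seq i <- iota 0 M | (a <= i < b)%N].
  by rewrite -val_enum_ord filter_map.
apply: (sorted_eq ltn_trans) => //.
- by move=> x y; lia.
- exact: iota_ltn_sorted.
- by apply: sorted_filter; [exact: ltn_trans | exact: iota_ltn_sorted].
apply: uniq_perm; rewrite ?filter_uniq ?iota_uniq // => x.
by rewrite mem_filter !mem_iota; lia.
Qed.

(** Positions are counted from 1 in [height_seg] and from 0 in words, hence the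
    shift of the lower bound. *)
Lemma height_segE (M a b K S : nat) (w : 'S_M) :
  height_seg (a%:Z + 1) b%:Z (K%:Z - S%:Z) w =
  count id (take (b - a) (drop a (small_word (K - S) w))).
Proof.
rewrite /small_word -map_drop -map_take take_drop_enum_ord count_map.
rewrite count_filter /height_seg cardsE cardE enumT -size_filter.
rewrite unlock; congr size; apply: eq_filter => i.
by rewrite /in_mem /=; lia.
Qed.

Lemma heightE (M a b K S : nat) (w : 'S_M) : (a <= b)%N ->
  height (b%:Z - a%:Z) (K%:Z - S%:Z) w =
  count id (take (b - a) (small_word (K - S) w)).
Proof.
move=> leab; rewrite -[small_word _ _]drop0 -[(b - a)%N]subn0 -height_segE.
by rewrite /height; congr height_seg; lia.
Qed.

Lemma multi_heightE (M r K : nat) (L s : nat -> nat) (w : 'S_M) :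
  L 0%N = 0%N ->
  (multi_height r L K%:Z w == [tuple s i | i < r]) =
  all (fun i => count id (take (L i.+1 - L i) (drop (L i - L 0%N)
                                                   (small_word K w))) == s i)
      (index_iota 0 r).
Proof.
move=> L0.
have segE i : (if i == 0%N then height (L 1%N)%:Z K%:Z w
     else height_seg ((L i)%:Z + 1) (L i.+1)%:Z K%:Z w) =
   count id (take (L i.+1 - L i) (drop (L i - L 0%N) (small_word K w))).
  rewrite L0 subn0 -[K in small_word K]subn0 -height_segE subr0.
  by case: i => [|i] //=; rewrite L0.
apply/eqP/allP => [eq_tuple i|eq_all].
  rewrite mem_index_iota /= => ltir.
  have /(congr1 (fun t => tnth t (Ordinal ltir))) := eq_tuple.
  by rewrite !tnth_mktuple segE => ->.
apply: eq_from_tnth => i; rewrite !tnth_mktuple segE.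
by apply/eqP/eq_all; rewrite mem_index_iota /=.
Qed.

Theorem proposition3p2 (R : realFieldType) (q : R) (hq : 0 <= q < 1)
  (N r K : nat) (hr : (1 <= r)%N) (hK : (1 <= K <= N)%N)
  (L : nat -> nat) (hL0 : L 0%N = 0%N) (hL1 : (1 <= L 1%N)%N)
  (hLmono : forall i : nat, (1 <= i < r)%N -> (L i <= L i.+1)%N)
  (hLN : (L r <= N)%N)
  (s : nat -> nat)
  (hs : forall i : nat, (1 <= i <= r)%N ->
     Num.max ((L i)%:Z - (L i.-1)%:Z + K%:Z - N%:Z) 0 <= (s i)%:Z
       <= Num.min ((L i)%:Z - (L i.-1)%:Z) K%:Z) :
  mallows q [set w : 'S_N | multi_height r L K%:Z w == [tuple s i.+1 | i < r]]
  = \prod_(1 <= i < r.+1)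
      mallows q [set w : 'S_(N - L i.-1) |
        height ((L i)%:Z - (L i.-1)%:Z) (K%:Z - \sum_(1 <= j < i) (s j)%:Z) w
        == s i].
Proof.
have homoL i j : (i <= j <= r)%N -> (L i <= L j)%N.
  elim: j => [|j IHj]; first by rewrite leqn0 => /andP[/eqP->].
  rewrite leq_eqVlt ltnS => /andP[/predU1P[-> //|leij] ltjr].
  apply: leq_trans (IHj _) _; first by rewrite leij ltnW.
  by case: j {IHj leij} ltjr => [|j] ltjr; [rewrite hL0 | exact: hLmono].
have := mean_blocks hq K (fun i => s i.+1) homoL hLN (leq0n r).
rewrite big_geq // subn0 [in (N - L 0)%N]hL0 subn0.
rewrite -(@mallows_mean _ _ _ _
  [set w : 'S_N | multi_height r L K%:Z w == [tuple s i.+1 | i < r]]);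
  last first.
  by move=> w; rewrite inE (@multi_heightE _ _ _ _ (fun i => s i.+1)).
move=> ->; rewrite big_add1 /=; apply: eq_big_nat => i ltir /=.
symmetry; apply: mallows_mean => w; rewrite inE big_add1 /=.
by rewrite -(big_morph Posz PoszD (erefl (0 : int))) heightE // homoL // leqnSn.
Qed.
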